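(* Let $A$ be a rooted directed tree and let $\lambda=(\lambda_u)_{u\in A}$ be a weight such that the induced weighted backward shift $B_\lambda$ is bounded on $\ell^1(A)$. The following are equivalent. (i) $B_\lambda$ is hypercyclic. (ii) $B_\lambda$ supports a hypercyclic algebra. (iii) $B_\lambda$ supports a dense, countably generated, free hypercyclic algebra.
   Context: All scalars are complex. A directed tree is a connected directed graph $(A,E)$ with countable vertex set $A$ and edge set $E\subset\{(a,b)\in A\times A: a\ne b\}$, having no cycles, and such that each vertex $b$ has at most one parent, i.e. a vertex $a$ with $(a,b)\in E$. There is at most one vertex without a parent, called the root; the tree is rooted if it has a root. $\mathrm{Chi}(v)$ is the set of children of $v$ (vertices whose parent is $v$). All trees are assumed leafless: every vertex has at least one child (possibly infinitely many). A weight is a family $\lambda=(\lambda_v)_{v\in A}$ of non-zero scalars. The weighted backward shift is $(B_\lambda f)(v)=\sum_{u\in\mathrm{Chi}(v)}\lambda_uf(u)$ for $f\in\mathbb{C}^A$, $v\in A$. $\ell^1(A)$ is the space of $f\in\mathbb{C}^A$ with $\|f\|_1=\sum_{v\in A}|f(v)|<\infty$; it is a Banach algebra for the coordinatewise product $(fg)(v)=f(v)g(v)$. $HC(T)$ is the set of hypercyclic vectors of $T$, i.e. vectors $x$ whose orbit $\{T^nx:n\ge0\}$ is dense; $T$ is hypercyclic if $HC(T)\neq\varnothing$. A hypercyclic algebra for $T$ is a subalgebra, not $\{0\}$, contained in $HC(T)\cup\{0\}$. It is dense if it is dense in the whole space, and countably generated and free if it is generated by a countably infinite set $G$ that is algebraically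 independent: $P(g_1,\dots,g_d)\ne0$ for all $d\geq 1$, distinct $g_1,\dots,g_d\in G$ and every non-zero polynomial $P$ in $d$ commuting variables without constant term. *)

(* Defs.v *)
From HB Require Import structures.
From Stdlib Require Import Relation_Operators.
From mathcomp Require Import all_boot all_order all_algebra.
From mathcomp Require Import complex.
From mathcomp Require Import boolp classical_sets functions cardinality fsbigop.
From mathcomp Require Import reals ereal topology normedtype esum.
(* The notations of mpoly clash with those of MathComp-Analysis. *)
From mathcomp Require Import (canonicals) mpoly.

Set Implicit Arguments.
Unset Strict Implicit.
Unset Printing Implicit Defensive.

Import Order.TTheory GRing.Theory Num.Theory.
Import ComplexField.Normc.

Local Open Scope classical_set_scope.
Local Open Scope ring_scope.

Section DirectedTrees.
Variables (A : countType) (E : set (A * A)).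

Definition edge (a b : A) : Prop := E (a, b).

(* A cycle is a directed closed walk of positive length. Since every vertex has
   at most one parent, this also excludes undirected cycles. *)
Record directed_tree : Prop := DirectedTree {
  tree_irrefl : forall a b, E (a, b) -> a <> b;
  tree_connected : forall a b, clos_refl_sym_trans A edge a b;
  tree_acyclic : forall a, ~ clos_trans A edge a a;
  tree_one_parent : forall a a' b, E (a, b) -> E (a', b) -> a = a' }.

Definition is_root (r : A) : Prop := forall a, ~ E (a, r).

Definition rooted : Prop := exists r, is_root r.

Definition Chi (v : A) : set A := [set u | E (v, u)].

Definition leafless : Prop := forall v, Chi v !=set0.

End DirectedTrees.

Section Ell1Norm.
Variables (R : realType) (A : countType).
Implicit Types f g : A -> R[i].

Definition norm1 f : \bar R := \esum_(v in [set: A]) (normc (f v))%:E.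

Lemma normc_ge0 (z : R[i]) : 0 <= normc z.
Proof. by case: z => a b; exact: sqrtr_ge0. Qed.

Lemma norm1_ge0 f : (0 <= norm1 f)%E.
Proof. by apply: esum_ge0 => v _; rewrite lee_fin normc_ge0. Qed.

Lemma le_norm1 f g : (forall v, normc (f v) <= normc (g v)) ->
  (norm1 f <= norm1 g)%E.
Proof. by move=> fg; apply: le_esum => v _; rewrite lee_fin fg. Qed.

Lemma normc_le_norm1 f v : ((normc (f v))%:E <= norm1 f)%E.
Proof.
apply: esum_ge; exists [set v]; last by rewrite fsbig_set1.
by split; [exact: finite_set1|exact: subsetT].
Qed.

Lemma norm1D f g : (norm1 (fun v => (f v + g v)%R) <= norm1 f + norm1 g)%E.
Proof.
rewrite -esumD => [|v _|v _]; rewrite ?lee_fin ?normc_ge0//.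
by apply: le_esum => v _; rewrite lee_fin le_normcD.
Qed.

Lemma norm1Z (c : R[i]) f :
  norm1 (fun v => c * f v) = ((normc c)%:E * norm1 f)%E.
Proof.
rewrite /norm1 /esum -ereal_supZl ?normc_ge0//; last first.
  apply/set0P; exists 0%E, set0; first exact: fsets_set0.
  by rewrite fsbig_set0.
rewrite image_comp; congr ereal_sup; apply: eq_imagel => F _ /=.
rewrite ge0_mule_fsumr => [|v]; last by rewrite lee_fin normc_ge0.
by apply: eq_fsbigr => v _; rewrite normcM EFinM.
Qed.

(* The codomain is R[i]^o because this is what makes the functions a module
   over R[i]: on R[i] itself the library only provides the scaling by R. *)
Definition ell1_pred : {pred A -> R[i]^o} :=
  mem [set f : A -> R[i]^o | (norm1 f < +oo)%E].

Lemma ell1_submod_closed : submod_closed ell1_pred.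
Proof.
split=> [|c f g].
  rewrite inE/=; rewrite /norm1 esum1 ?ltry// => v _.
  by rewrite [normc _](@normc0 R).
rewrite !inE/= => fi gi; apply: le_lt_trans (norm1D (fun v => c * f v) g) _.
by rewrite lte_add_pinfty// norm1Z lte_mul_pinfty// lee_fin normc_ge0.
Qed.

HB.instance Definition _ :=
  GRing.isSubmodClosed.Build _ _ ell1_pred ell1_submod_closed.

Record ell1 := Ell1 { ell1_val : A -> R[i]^o ; _ : ell1_val \in ell1_pred }.

HB.instance Definition _ := [isSub for ell1_val].
HB.instance Definition _ := [Choice of ell1 by <:].
HB.instance Definition _ := [SubChoice_isSubLmodule of ell1 by <:].

Definition ell1_fun (f : ell1) : A -> R[i] := ell1_val f.
Coercion ell1_fun : ell1 >-> Funclass.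

Lemma norm1_fin (f : ell1) : norm1 f \is a fin_num.
Proof.
rewrite ge0_fin_numE ?norm1_ge0//.
by have := valP f; rewrite inE.
Qed.

Definition ell1_norm (f : ell1) : R[i] := (fine (norm1 f))%:C%C.

Lemma ell1_normD (f g : ell1) : ell1_norm (f + g) <= ell1_norm f + ell1_norm g.
Proof.
rewrite /ell1_norm -rmorphD lecR -fineD ?norm1_fin//.
by rewrite fine_le ?fin_numD ?norm1_fin//; exact: norm1D.
Qed.

Lemma ell1_normZ (c : R[i]) (f : ell1) : ell1_norm (c *: f) = `|c| * ell1_norm f.
Proof.
rewrite /ell1_norm.
have -> : norm1 (c *: f) = ((normc c)%:E * norm1 f)%E by rewrite -norm1Z.
by rewrite fineM ?norm1_fin//= rmorphM.
Qed.

Lemma ell1_norm0_eq0 (f : ell1) : ell1_norm f = 0 -> f = 0.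
Proof.
move=> [f0]; apply/val_inj/funext => v /=; apply: (@eq0_normc R).
apply/eqP; rewrite eq_le normc_ge0 andbT -lee_fin.
by rewrite -f0 fineK ?norm1_fin// (normc_le_norm1 f).
Qed.

HB.instance Definition _ := Lmodule_isNormed.Build R[i] ell1
  ell1_normD ell1_normZ ell1_norm0_eq0.

Lemma ell1_mul_subproof (f g : ell1) :
  (fun v => f v * g v : R[i]^o) \in ell1_pred.
Proof.
rewrite inE/=.
apply: (@le_lt_trans _ _ (norm1 (fun v => (fine (norm1 g))%:C%C * f v))).
  apply: le_norm1 => v; rewrite !normcM mulrC ler_wpM2r ?normc_ge0//.
  rewrite [leRHS](_ : _ = fine (norm1 g)).
    by rewrite -lee_fin fineK ?norm1_fin ?normc_le_norm1.
  by rewrite /= expr0n addr0 sqrtr_sqr ger0_norm ?fine_ge0 ?norm1_ge0.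
rewrite norm1Z lte_mul_pinfty ?lee_fin ?normc_ge0//.
by have := valP f; rewrite inE.
Qed.

Definition ell1_mul (f g : ell1) : ell1 := Ell1 (ell1_mul_subproof f g).

End Ell1Norm.

(* Unconditional summation: the finite partial sums over subsets of D converge
   to s along the finite subsets of D ordered by inclusion. *)
Definition has_sum (R : realType) (A : countType) (D : set A)
    (x : A -> R[i]) (s : R[i]) : Prop :=
  forall e : R, 0 < e -> exists2 F, fsets D F &
    forall F', fsets D F' -> F `<=` F' -> normc (\sum_(u \in F') x u - s) < e.

(* T is the operator on ell1 given by the formula defining B_lambda; as sums
   are unique, there is at most one such T. *)
Definition is_weighted_backward_shift (R : realType) (A : countType)
    (E : set (A * A)) (lambda : A -> R[i]) (T : ell1 R A -> ell1 R A) : Prop :=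
  forall (f : ell1 R A) v, has_sum (Chi E v) (fun u => lambda u * f u) (T f v).

Definition bounded_operator (K : numFieldType) (X : normedModType K)
    (T : X -> X) : Prop :=
  exists M : K, forall x, `|T x| <= M * `|x|.

Definition HC (X : topologicalType) (T : X -> X) : set X :=
  [set x | dense (range (fun n => iter n T x))].

Definition hypercyclic (X : topologicalType) (T : X -> X) : Prop :=
  HC T !=set0.

Section HypercyclicAlgebras.
Variables (R : realType) (A : countType).
Local Notation X := (ell1 R A).
Implicit Types (T : X -> X) (S G : set X).

(* ell1 has no unit when A is infinite, and subalgebras need not contain it. *)
Definition subalgebra S : Prop :=
  [/\ S 0,
      forall f g, S f -> S g -> S (f + g),
      forall (c : R[i]) f, S f -> S (c *: f) &
      forall f g, S f -> S g -> S (ell1_mul f g)].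

Definition generated_subalgebra G : set X := smallest subalgebra G.

Definition hypercyclic_algebra T S : Prop :=
  [/\ subalgebra S, S <> [set 0] & S `<=` HC T `|` [set 0]].

(* P(g_1, ..., g_d): as the product is coordinatewise, so is the evaluation. *)
Definition poly_eval (d : nat) (P : mpoly.mpoly d R[i]) (g : 'I_d -> X) :
    A -> R[i] :=
  fun v => mpoly.meval (fun i => g i v) P.

Definition algebraically_independent G : Prop :=
  forall (d : nat) (g : 'I_d -> X) (P : mpoly.mpoly d R[i]),
    (0 < d)%N -> injective g -> (forall i, G (g i)) ->
    P <> 0 -> mpoly.mcoeff mpoly.mnm0 P = 0 ->
    poly_eval P g <> (fun=> 0).

Definition countably_generated_free S : Prop :=
  exists G, [/\ (G #= [set: nat])%card, algebraically_independent G &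
                S = generated_subalgebra G].

End HypercyclicAlgebras.

(* Main.v *)
Require Import Defs.
From Stdlib Require Import Relation_Operators Operators_Properties.
From mathcomp Require Import all_boot all_order all_algebra.
From mathcomp Require Import complex.
From mathcomp Require Import boolp classical_sets functions cardinality fsbigop.
From mathcomp Require Import reals ereal topology normedtype esum.
From mathcomp Require Import (canonicals) mpoly.
From mathcomp Require Import zify ring lra.

(** A hypercyclic algebra makes B hypercyclic, because it contains a non-zero,
    hence hypercyclic, vector. The content of the theorem is that a hypercyclic B
    has a dense, free, countably generated hypercyclic algebra, and this is shown
    by an explicit construction of the generators.

    Let e_u be the basis vectors. In a rooted tree each of them is annihilated by
    some power of B (backward_shift_nilpotent), and B^n e_u is always a multiple of
    a basis vector. If B is hypercyclic, then by hitting a large target one finds,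
    for every finite set F of vertices, arbitrarily large n such that each v in F
    has a descendant u with B^n e_u = c e_v and |c| as large as desired
    (shift_growth). Hence, for a finitely supported target h and a power N > 0,
    there is a tiny vector s, with the entry (h v / c)^(1/N) at u, such that
    B^n (s^N) = h exactly, whereas B^n (s^m) is tiny for m > N (stage_exists).

    The generators are g_i = h_i + sum over k > i of s_k^((K_k + 1)^i), where the
    h_k are finitely supported and dense, and the s_k are built one after the other
    for the targets h_k, with pairwise disjoint supports. As the product is
    coordinatewise, a polynomial P without constant term acts on each of these
    pieces separately. At the time n_k attached to stage k, all earlier pieces are
    annihilated, and the later ones have been chosen so small that B^(n_k) keeps
    them small (sigma_tail, poly_tail). On the piece of stage k itself, P becomes a
    polynomial in s_k by Kronecker substitution; for a large base K_k distinct
    monomials of P become distinct powers of s_k, so that the one of least weight,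
    say s_k^N with coefficient c, is dominant (kron_dominant). If stage k was built
    for this power N, then B^(n_k) P(g) is close to c h_k (poly_stage). As every
    pair (K, N) recurs with a dense set of targets (targets_exist), P(g) is
    hypercyclic (poly_hypercyclic). A stage depends on K, N and its target, but not
    on the coefficients of P, so that countably many stages serve all polynomials.

    Freeness follows, since 0 is not hypercyclic, and density holds because g_i is
    close to h_i. *)

Set Implicit Arguments.
Unset Strict Implicit.
Unset Printing Implicit Defensive.

Import Order.TTheory GRing.Theory Num.Theory.
Import ComplexField.Normc.
Local Open Scope classical_set_scope.
Local Open Scope ring_scope.

(** * Norms and finite sums in ell1 *)

Section Modulus.
Variable R : realType.
Implicit Types z : R[i].

Lemma modulus0 : normc (0 : R[i]) = 0. Proof. exact: normc0. Qed.

Lemma modulus1 : normc (1 : R[i]) = 1. Proof. exact: normc1. Qed.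

Lemma modulusX z n : normc (z ^+ n) = normc z ^+ n.
Proof.
by elim: n => [|n IH]; rewrite ?expr0 ?modulus1// !exprS normcM IH.
Qed.

Lemma modulus_real (r : R) : 0 <= r -> normc (r%:C)%C = r.
Proof. by move=> r0; rewrite /= expr0n addr0 sqrtr_sqr ger0_norm. Qed.

Lemma modulus_sum I (r : seq I) (F : I -> R[i]) :
  normc (\sum_(i <- r) F i) <= \sum_(i <- r) normc (F i).
Proof.
elim: r => [|i r IH]; first by rewrite !big_nil modulus0.
by rewrite !big_cons (le_trans (le_normcD _ _))// lerD2l.
Qed.

End Modulus.

Section Half.
Variable R : realType.
Local Notation half := (2^-1 : R).

Lemma half_gt0 k : 0 < half ^+ k.
Proof. by rewrite exprn_gt0// invr_gt0. Qed.

(** Telescoping. *)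
Lemma half_sum k l : (k <= l)%N ->
  \sum_(k <= j < l) half ^+ j.+1 <= half ^+ k - half ^+ l.
Proof.
elim: l => [|l IH]; first by rewrite leqn0 => /eqP ->; rewrite big_geq// subrr.
rewrite leq_eqVlt => /orP[/eqP <-|kl]; first by rewrite big_geq// subrr.
rewrite big_nat_recr//=; have := IH kl; rewrite [half ^+ l.+1]exprS.
lra.
Qed.

Lemma half_small (e : R) : 0 < e -> exists k0, forall k, (k0 <= k)%N -> half ^+ k < e.
Proof.
move=> e0; have [k ke] : exists k : nat, e^-1 < k%:R.
  by exists (Num.bound e^-1); apply: archi_boundP; rewrite invr_ge0 ltW.
exists k => l kl; rewrite exprVn -[e]invrK ltf_pV2 ?posrE ?invr_gt0 ?exprn_gt0//.
rewrite (lt_trans ke)// -natrX ltr_nat.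
by rewrite (leq_ltn_trans kl)// ltn_expl.
Qed.

End Half.

Section Norm.
Variables (R : realType) (A : countType).
Local Notation X := (ell1 R A).
Implicit Types (x y : X) (v u : A).

(** The norm of ell1 takes its values in R[i]; all estimates are made with this
    real-valued version of it. *)
Definition nrm x : R := fine (norm1 x).

Lemma nrmE x : (nrm x)%:E = norm1 x.
Proof. by rewrite fineK ?norm1_fin. Qed.

Lemma normrE x : `|x| = (nrm x)%:C%C.
Proof. by []. Qed.

Lemma nrm_ge0 x : 0 <= nrm x.
Proof. by rewrite -lee_fin nrmE norm1_ge0. Qed.

Lemma nrmD x y : nrm (x + y) <= nrm x + nrm y.
Proof.
have := ell1_normD x y; rewrite /ell1_norm -rmorphD lecR; exact.
Qed.

Lemma nrmZ (c : R[i]) x : nrm (c *: x) = normc c * nrm x.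
Proof.
by rewrite /nrm -[norm1 (c *: x)]/(norm1 (fun v => c * x v)) norm1Z fineM// norm1_fin.
Qed.

Lemma nrm0 : nrm 0 = 0.
Proof. by rewrite /nrm /norm1 esum1// => v _; rewrite [normc _](@normc0 R). Qed.

Lemma nrmN x : nrm (- x) = nrm x.
Proof. by rewrite -scaleN1r nrmZ normcN modulus1 mul1r. Qed.

Lemma nrm_sub_sym x y : nrm (x - y) = nrm (y - x).
Proof. by rewrite -nrmN opprB. Qed.

Lemma nrm_sub_trans y x z : nrm (x - z) <= nrm (x - y) + nrm (y - z).
Proof. by rewrite -[x - z](subrKA y) nrmD. Qed.

Lemma nrm_sum I (r : seq I) (P : pred I) (F : I -> X) :
  nrm (\sum_(i <- r | P i) F i) <= \sum_(i <- r | P i) nrm (F i).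
Proof.
elim/big_rec2: _ => [|i y x _ xy]; first by rewrite nrm0.
by rewrite (le_trans (nrmD _ _))// lerD2l.
Qed.

Lemma normc_le_nrm x v : normc (x v) <= nrm x.
Proof. by rewrite -lee_fin nrmE normc_le_norm1. Qed.

Lemma ell1P x y : (forall v, x v = y v) -> x = y.
Proof. by move=> xy; apply/val_inj/funext. Qed.

Lemma ell1_sumE I (r : seq I) (F : I -> X) v :
  (\sum_(i <- r) F i) v = \sum_(i <- r) F i v.
Proof.
elim: r => [|i r IH]; first by rewrite !big_nil.
by rewrite !big_cons -IH.
Qed.

Lemma norm1_le_seq (f : A -> R[i]) (C : R) :
  (forall r : seq A, uniq r -> \sum_(v <- r) normc (f v) <= C) ->
  (norm1 f <= C%:E)%E.
Proof.
move=> fC; apply: ge_ereal_sup => _ [F [/finite_seqP[r ->] _] <-].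
have -> : [set` r] = [set` undup r].
  by apply/seteqP; split=> v /=; rewrite mem_undup.
by rewrite -fsbig_seq ?undup_uniq// sumEFin lee_fin fC ?undup_uniq.
Qed.

Lemma sum_le_norm1 (f : A -> R[i]) (r : seq A) : uniq r ->
  ((\sum_(v <- r) normc (f v))%:E <= norm1 f)%E.
Proof.
move=> ur; rewrite -sumEFin; apply: esum_ge; exists [set` r].
  by split=> //; exact: finite_seq.
by rewrite -fsbig_seq.
Qed.

Lemma sum_le_nrm x (r : seq A) : uniq r -> \sum_(v <- r) normc (x v) <= nrm x.
Proof. by move=> ur; rewrite -lee_fin nrmE sum_le_norm1. Qed.

Lemma ell1_subproof (f : A -> R[i]) :
  (norm1 f < +oo)%E -> (f : A -> R[i]^o) \in @ell1_pred R A.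
Proof. by rewrite inE. Qed.

(** Elements of ell1 are produced from functions by bounding their finite sums,
    so that no limit of a sequence in ell1 has to be formed. *)
Lemma ell1_exists (f : A -> R[i]) (C : R) : (norm1 f <= C%:E)%E ->
  exists2 x : X, (forall v, x v = f v) & nrm x <= C.
Proof.
move=> fC; have ff : (norm1 f < +oo)%E by rewrite (le_lt_trans fC)// ltry.
by exists (Ell1 (ell1_subproof ff)) => //; rewrite -lee_fin nrmE.
Qed.

Lemma ell1_dominated (f : A -> R[i]) y (C : R) : 0 <= C ->
  (forall v, normc (f v) <= C * normc (y v)) ->
  exists2 x : X, (forall v, x v = f v) & nrm x <= C * nrm y.
Proof.
move=> C0 fy; apply: ell1_exists.
have yE : nrm (C%:C%C *: y) = C * nrm y.
  by rewrite nrmZ modulus_real.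
rewrite -yE nrmE; apply: le_norm1 => v; rewrite normcM.
by rewrite modulus_real.
Qed.

Lemma delta_subproof v :
  (norm1 (fun u => if u == v then 1%R else 0%R : R[i]) <= 1%:E)%E.
Proof.
apply: norm1_le_seq => r ur; rewrite (bigID (pred1 v))/=.
rewrite [X in _ + X]big1 => [|u /negPf->]; last exact: modulus0.
rewrite addr0 (eq_bigr (fun=> 1)) => [|u ->]; last exact: modulus1.
rewrite -big_filter big_const_seq count_predT.
have : (size [seq u <- r | u == v] <= 1)%N.
  by rewrite size_filter count_uniq_mem// leq_b1.
by case: size => [|[|]]//=; rewrite ?addr0 ?ler01.
Qed.

Definition delta v : X :=
  Ell1 (ell1_subproof (le_lt_trans (delta_subproof v) (ltry 1))).

Lemma deltaE v u : delta v u = if u == v then 1 else 0.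
Proof. by []. Qed.

Lemma nrm_delta v : nrm (delta v) = 1.
Proof.
apply/eqP; rewrite eq_le -lee_fin nrmE delta_subproof/=.
by apply: le_trans (normc_le_nrm _ v); rewrite deltaE eqxx modulus1.
Qed.

Lemma delta_sumE (r : seq A) (f : A -> R[i]) v : uniq r ->
  (\sum_(u <- r) f u *: delta u) v = if v \in r then f v else 0.
Proof.
move=> ur; rewrite ell1_sumE; case: ifP => [vr|/negP vr].
  rewrite (bigD1_seq v)//= [X in _ + X]big1 => [|u uv].
    by rewrite addr0; change (f v * delta v v = f v); rewrite deltaE eqxx mulr1.
  change (f u * delta u v = 0).
  by rewrite deltaE eq_sym (negPf uv) mulr0.
rewrite big_seq big1// => u ur'; change (f u * delta u v = 0).
rewrite deltaE; case: eqP => [vu|_]; last by rewrite mulr0.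
by case: vr; rewrite vu.
Qed.

(** A finite sum that nearly exhausts the norm leaves a small remainder. *)
Lemma truncation x (e : R) : 0 < e ->
  exists r : seq A, uniq r /\ nrm (x - \sum_(v <- r) x v *: delta v) <= e.
Proof.
move=> e0.
have [_ [F [/finite_seqP[r0 ->] _] <-]] := ub_ereal_sup_adherent e0 (norm1_fin x).
have -> : [set` r0] = [set` undup r0].
  by apply/seteqP; split=> v /=; rewrite mem_undup.
set r := undup r0; have ur : uniq r by rewrite undup_uniq.
rewrite -fsbig_seq// sumEFin -[ereal_sup _]/(norm1 x) -nrmE -EFinB lte_fin => xr.
exists r; split=> //; rewrite -lee_fin nrmE; apply: norm1_le_seq => s us.
rewrite (eq_bigr (fun v => if v \notin r then normc (x v) else 0)) => [|v _]; last first.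
  change (normc (x v - (\sum_(u <- r) x u *: delta u) v) =
    if v \notin r then normc (x v) else 0).
  by rewrite delta_sumE//; case: (v \in r); rewrite /= ?subr0// subrr modulus0.
rewrite -big_mkcond/=.
have := @sum_le_nrm x (r ++ [seq v <- s | v \notin r]).
have urs : uniq (r ++ [seq v <- s | v \notin r]).
  rewrite cat_uniq ur filter_uniq// andbT.
  by apply/hasPn => v; rewrite mem_filter => /andP[].
move/(_ urs); rewrite big_cat/= big_filter; lra.
Qed.

Lemma dense_nrmP (S : set X) :
  (forall x (e : R), 0 < e -> exists2 y, S y & nrm (y - x) < e) <-> dense S.
Proof.
split=> [H O [x Ox] Oo|H x e e0].
  move: Oo; rewrite openE => /(_ x Ox); rewrite /interior -nbhs_ballE.
  case=> e /= e0 xe.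
  case: e e0 xe => e ei; rewrite ltcE /= => /andP[/eqP-> e0] xe.
  move: (e0).
  move=> /(H x)[y Sy yx]; exists y; split=> //; apply: xe.
  by rewrite -ball_normE/= distrC normrE ltcR.
have [||] := H (ball (x : X) (e%:C%C)).
- by exists x; apply: ballxx; rewrite ltcR.
- by apply: ball_open; rewrite ltcR.
by move=> y [xy Sy]; exists y => //; move: xy; rewrite -ball_normE/= distrC normrE ltcR.
Qed.

End Norm.

(** * Unconditional sums *)

Section Sums.
Variables (R : realType) (A : countType) (D : set A).
Implicit Types (f g : A -> R[i]) (s t : R[i]).

Lemma has_sum_unique f s t : has_sum D f s -> has_sum D f t -> s = t.
Proof.
move=> fs ft; apply/eqP; rewrite -subr_eq0; apply/eqP/eq0_normc.
apply/eqP; rewrite eq_le normc_ge0 andbT; apply/ler_addgt0Pr => e e0.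
rewrite add0r; have e2 : 0 < e / 2 by rewrite divr_gt0.
have [F [Ff FD] Fs] := fs _ e2; have [G [Gf GD] Gt] := ft _ e2.
have FGD : fsets D (F `|` G).
  by split; [rewrite finite_setU|rewrite subUset].
have := Fs _ FGD (@subsetUl _ F G); have := Gt _ FGD (@subsetUr _ F G).
set a := \sum_(_ \in _) _ => at_ as_.
have -> : s - t = (a - t) - (a - s) by ring.
rewrite (le_trans (le_normcD _ _))// normcN; lra.
Qed.

Lemma has_sum_linear (c : R[i]) f g s t :
  has_sum D f s -> has_sum D g t ->
  has_sum D (fun v => c * f v + g v) (c * s + t).
Proof.
move=> fs gt e e0; have c0 : 0 < normc c + 1 by rewrite ltr_wpDl ?normc_ge0.
have e2 : 0 < e / 2 / (normc c + 1) by rewrite !divr_gt0.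
have e2' : 0 < e / 2 by rewrite divr_gt0.
have [F [Ff FD] Fs] := fs _ e2; have [G [Gf GD] Gt] := gt _ e2'.
exists (F `|` G).
  by split; [rewrite finite_setU|rewrite subUset].
move=> H [Hf HD]; rewrite subUset => -[FH GH].
have := Fs H (conj Hf HD) FH; have := Gt H (conj Hf HD) GH.
rewrite fsbig_split//=.
rewrite (_ : \sum_(v \in H) c * f v = c * \sum_(v \in H) f v); last first.
  by rewrite !fsbig_finite// mulr_sumr.
set a := \sum_(_ \in _) _; set b := \sum_(_ \in _) _ => at_ bs.
have -> : c * b + a - (c * s + t) = c * (b - s) + (a - t).
  by ring.
rewrite (le_lt_trans (le_normcD _ _))// normcM.
have : normc c * normc (b - s) <= (normc c + 1) * normc (b - s).
  by rewrite ler_wpM2r ?normc_ge0// lerDl.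
have : (normc c + 1) * normc (b - s) < e / 2.
  by rewrite mulrC -ltr_pdivlMr.
lra.
Qed.

Lemma has_sum_single f u :
  (forall v, v <> u -> f v = 0) -> has_sum D f (if `[< D u >] then f u else 0).
Proof.
move=> fu e e0; case: asboolP => Du; last first.
  exists set0; first exact: fsets_set0.
  move=> F [Ff FD] _; rewrite fsbig1 ?subrr ?modulus0// => v /FD Dv.
  by apply: fu => vu; apply: Du; rewrite -vu.
exists [set u]; first by split; [exact: finite_set1|move=> v ->].
move=> F [Ff FD] uF; rewrite -(@fsbig_widen _ _ _ _ [set u])//.
  by rewrite fsbig_set1 subrr modulus0.
by move=> v [_ vu]; exact: fu.
Qed.

End Sums.

(** * The backward shift of a rooted tree *)

(** What the argument uses of the tree: basis vectors go to multiples of basis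
    vectors and, because a path towards the root ends at the root, each of them is
    eventually annihilated. The bound M is at least 1 so that its powers are
    monotone. *)
Record nilpotent_shift (R : realType) (A : countType)
    (T : ell1 R A -> ell1 R A) (M : R) : Prop := NilpotentShift {
  shift_linear : forall (c : R[i]) x y, T (c *: x + y) = c *: T x + T y;
  shift_ge1 : 1 <= M;
  shift_bound : forall x, nrm (T x) <= M * nrm x;
  shift_delta : forall u, exists c a, T (delta R u) = c *: delta R a;
  shift_nil : forall u, exists n, iter n T (delta R u) = 0 }.

Section TreeShift.
Variables (R : realType) (A : countType) (E : set (A * A)).
Variables (lambda : A -> R[i]) (B : ell1 R A -> ell1 R A).
Hypotheses (treeE : directed_tree E) (rootE : rooted E).
Hypotheses (shiftB : is_weighted_backward_shift E lambda B).
Hypothesis boundB : bounded_operator B.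

Lemma backward_shift_linear (c : R[i]) x y :
  B (c *: x + y) = c *: B x + B y.
Proof.
apply: ell1P => v; change (B (c *: x + y) v = c * B x v + B y v).
apply: has_sum_unique (shiftB _ v) _.
rewrite (_ : (fun u => _) = (fun u => c * (lambda u * x u) + lambda u * y u)).
  exact: has_sum_linear.
by apply/funext => u; change (lambda u * (c * x u + y u) = c * (lambda u * x u) + lambda u * y u); ring.
Qed.

Lemma backward_shift_deltaE u v :
  B (delta R u) v = if `[< E (v, u) >] then lambda u else 0.
Proof.
apply: has_sum_unique (shiftB _ v) _.
have := @has_sum_single R A (Chi E v) (fun w => lambda w * delta R u w) u.
rewrite deltaE eqxx mulr1; apply => w wu.
by rewrite deltaE; case: eqP => // _; rewrite mulr0.
Qed.

Lemma backward_shift_delta_child a u :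
  E (a, u) -> B (delta R u) = lambda u *: delta R a.
Proof.
move=> au; apply: ell1P => v; rewrite backward_shift_deltaE.
rewrite -[RHS]/(lambda u * delta R a v) deltaE.
case: asboolP => [vu|nvu].
  by rewrite (tree_one_parent treeE vu au) eqxx mulr1.
by case: eqP => [va|]; rewrite ?mulr0//; case: nvu; rewrite va.
Qed.

Lemma backward_shift_delta_root r : is_root E r -> B (delta R r) = 0.
Proof.
move=> rr; apply: ell1P => v; rewrite backward_shift_deltaE.
by case: asboolP => // /rr.
Qed.

(** A rooted tree is generated downwards from its root, which gives induction
    along edges. *)
Lemma tree_root_ind (P : A -> Prop) :
  (forall r, is_root E r -> P r) ->
  (forall a b, E (a, b) -> P a -> P b) -> forall v, P v.
Proof.
move=> Pr PE v; have [r rr] := rootE.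
(* Being a descendant of r is invariant along edges in both directions,
   because parents are unique and r has none. *)
have desc a b : clos_refl_sym_trans A (edge E) a b ->
    clos_refl_trans A (edge E) r a <-> clos_refl_trans A (edge E) r b.
  elim=> {a b} [a b ab|//|a b _ [? ?]|a b c _ [ab ba] _ [bc cb]].
  - split=> [ra|rb]; first exact: rt_trans ra (rt_step _ _ _ _ ab).
    move: ab; case/clos_rt_rtn1_iff: rb => [/rr//|a' {}b a'b].
    move/clos_rt_rtn1_iff => ra' ab.
    by rewrite (tree_one_parent treeE ab a'b).
  - by split.
  - by split=> [/ab/bc|/cb/ba].
have := (desc _ _ (tree_connected treeE r v)).1 (rt_refl _ _ _).
by move/clos_rt_rtn1_iff; elim=> [|a b ab _ Pa]; [exact: Pr|exact: PE ab Pa].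
Qed.

Lemma backward_shift_nilpotent : exists M, nilpotent_shift B M.
Proof.
have B0 : B 0 = 0.
  have := backward_shift_linear (-1) 0 0.
  by rewrite !scaleN1r oppr0 addr0 addNr.
have BZ c x : B (c *: x) = c *: B x.
  by have := backward_shift_linear c x 0; rewrite B0 !addr0.
have iterZ n c x : iter n B (c *: x) = c *: iter n B x.
  by elim: n => //= n ->.
have [N BN] := boundB; exists (Num.max 1 (complex.Re N)); split.
- exact: backward_shift_linear.
- by rewrite le_max lexx.
- move=> x; have : (nrm (B x))%:C%C <= N * (nrm x)%:C%C := BN x.
  case: N {BN} => N N' /=.
  rewrite lecE/= => /andP[_]; rewrite mulr0 subr0 => /le_trans; apply.
  by rewrite ler_wpM2r ?nrm_ge0// le_max lexx orbT.
- apply: tree_root_ind => [r rr|a u au _].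
    by exists 0, r; rewrite scale0r backward_shift_delta_root.
  by exists (lambda u), a; exact: backward_shift_delta_child.
- apply: tree_root_ind => [r rr|a u au [n na]].
    by exists 1%N; rewrite /= backward_shift_delta_root.
  exists n.+1; rewrite iterSr (backward_shift_delta_child au) iterZ na.
  exact: scaler0.
Qed.

End TreeShift.

(** * Iterates of a nilpotent shift *)

Section Iterates.
Variables (R : realType) (A : countType) (T : ell1 R A -> ell1 R A) (M : R).
Hypothesis TM : nilpotent_shift T M.
Local Notation X := (ell1 R A).
Local Notation delta := (delta R).
Implicit Types (x y : X) (u v : A) (n : nat).

Lemma shift_iter_linear n (c : R[i]) x y :
  iter n T (c *: x + y) = c *: iter n T x + iter n T y.
Proof. by elim: n => //= n ->; exact: shift_linear TM _ _ _. Qed.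

Lemma shift_iterD n x y : iter n T (x + y) = iter n T x + iter n T y.
Proof. by have := shift_iter_linear n 1 x y; rewrite !scale1r. Qed.

Lemma shift_iter0 n : iter n T 0 = 0.
Proof.
have := shift_iter_linear n (-1) 0 0.
by rewrite !scaleN1r oppr0 addr0 addNr.
Qed.

Lemma shift_iterZ n (c : R[i]) x : iter n T (c *: x) = c *: iter n T x.
Proof. by have := shift_iter_linear n c x 0; rewrite shift_iter0 !addr0. Qed.

Lemma shift_iter_sum n I (r : seq I) (F : I -> X) :
  iter n T (\sum_(i <- r) F i) = \sum_(i <- r) iter n T (F i).
Proof.
elim: r => [|i r IH]; first by rewrite !big_nil shift_iter0.
by rewrite !big_cons shift_iterD IH.
Qed.

Lemma shiftM_gt0 : 0 < M.
Proof. exact: lt_le_trans ltr01 (shift_ge1 TM). Qed.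

Lemma nrm_shift_iter n x : nrm (iter n T x) <= M ^+ n * nrm x.
Proof.
elim: n => [|n IH]; first by rewrite mul1r.
rewrite iterS (le_trans (shift_bound TM _))// exprS -mulrA.
by rewrite ler_wpM2l// ltW// shiftM_gt0.
Qed.

Lemma shift_iter_delta n u : exists c a, iter n T (delta u) = c *: delta a.
Proof.
elim: n => [|n [c [a IH]]]; first by exists 1, u; rewrite scale1r.
have [d [b Tb]] := shift_delta TM a; exists (c * d), b.
by rewrite iterS IH; have := shift_iterZ 1 c (delta a) => /= ->; rewrite Tb scalerA.
Qed.

(** By linearity on the finite truncations of x, and by continuity in the limit:
    an entry of iter n T x is a combination, with the entries of x as weights, of
    the entries of the iterates of basis vectors. *)
Lemma shift_iter_coord_le n v x (C : R) : 0 <= C ->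
  (forall u, x u <> 0 -> normc (iter n T (delta u) v) <= C) ->
  normc (iter n T x v) <= C * nrm x.
Proof.
move=> C0 xC; apply/ler_addgt0Pr => e e0.
have Mn : 0 < M ^+ n by rewrite exprn_gt0// shiftM_gt0.
have eM : 0 < e / M ^+ n by rewrite divr_gt0.
have [r [ur xr]] := truncation x eM.
set y := \sum_(u <- r) x u *: delta u in xr.
have -> : iter n T x v = iter n T y v + iter n T (x - y) v.
  by rewrite -{1}(subrK y x) (shift_iterD n (x - y)) [RHS]addrC.
rewrite (le_trans (le_normcD _ _))// lerD//; last first.
  rewrite (le_trans (normc_le_nrm _ _))// (le_trans (nrm_shift_iter _ _))//.
  by rewrite mulrC -ler_pdivlMr.
rewrite shift_iter_sum ell1_sumE (le_trans (modulus_sum _ _))//.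
rewrite (@le_trans _ _ (\sum_(u <- r) C * normc (x u)))//; last first.
  by rewrite -mulr_sumr ler_wpM2l// sum_le_nrm.
apply: ler_sum => u _; rewrite shift_iterZ.
change (normc (x u * iter n T (delta u) v) <= C * normc (x u)).
rewrite normcM mulrC; have [->|/eqP xu] := eqVneq (x u) 0.
  by rewrite modulus0 !mulr0.
by rewrite ler_wpM2r ?normc_ge0// xC.
Qed.

Lemma shift_iter_vanish n x :
  (forall u, x u <> 0 -> iter n T (delta u) = 0) -> iter n T x = 0.
Proof.
move=> xn; apply: ell1P => v; apply: (@eq0_normc R).
apply/eqP; rewrite eq_le normc_ge0 andbT -(mul0r (nrm x)).
by apply: shift_iter_coord_le => // u /xn ->; rewrite [normc _]modulus0.
Qed.

Lemma shift_nil_bool u : exists n, iter n T (delta u) == 0.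
Proof. by have [n /eqP un] := shift_nil TM u; exists n. Qed.

(** For a weighted backward shift this is the depth of u plus one. A vector
    supported on levels at most n is annihilated by iter n T. *)
Definition level u : nat := ex_minn (shift_nil_bool u).

Lemma level_leP n u : reflect (iter n T (delta u) = 0) (level u <= n)%N.
Proof.
rewrite /level; case: ex_minnP => m /eqP um mmin; apply: (iffP idP) => [mn|/eqP].
  by rewrite -(subnK mn) iterD um shift_iter0.
exact: mmin.
Qed.

Lemma level_bound x (r : seq A) : (forall u, u \notin r -> x u = 0) ->
  exists n, forall u, x u <> 0 -> (level u <= n)%N.
Proof.
move=> xr; exists (\max_(u <- r) level u) => u xu.
have ur : u \in r by apply: contra_notT xu => /xr.
exact: leq_bigmax_seq.
Qed.

(** This is the characterization of hypercyclicity by the growth of the weights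
    along paths, in the direction used here. On ell1 the dual norm is a supremum,
    so a single descendant u of v already carries a large coefficient. *)
Lemma shift_growth : hypercyclic T -> forall (r : seq A) (C : R) n0,
  exists2 n, (n0 <= n)%N &
    forall v, v \in r -> exists u c, iter n T (delta u) = c *: delta v /\ C < normc c.
Proof.
move=> [x] /dense_nrmP Hx r C n0.
have [->|[w wr]] : r = [::] \/ exists w, w \in r.
  by case: (r) => [|w s]; [left|right; exists w; rewrite mem_head].
  by exists n0.
pose C' := Num.max C (M ^+ n0).
have C'0 : 0 <= C' by rewrite le_max exprn_ge0 ?orbT// ltW// shiftM_gt0.
have Cx : 0 <= C' * nrm x + 1 by rewrite addr_ge0// mulr_ge0// nrm_ge0.
(* The orbit comes near a vector whose entries on r exceed C' * nrm x. Up to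
   time n0 the norm of the orbit is at most M ^+ n0 * nrm x, which forces the
   time to be large; and an entry of iter n T x is at most nrm x times the
   largest coefficient of the basis vectors that feed it. *)
pose h : X := \sum_(v <- undup r) (C' * nrm x + 1)%:C%C *: delta v.
have [_ [n _ <-] xh] := Hx h 1 ltr01.
have big_v v : v \in r -> C' * nrm x < normc (iter n T x v).
  move=> vr; have hv : h v = (C' * nrm x + 1)%:C%C.
    have := @delta_sumE R A (undup r) (fun=> (C' * nrm x + 1)%:C%C) v.
    by rewrite undup_uniq mem_undup vr => ->.
  have : normc (h v) <= normc (iter n T x v) + normc ((iter n T x - h) v).
    have -> : h v = iter n T x v + (- (iter n T x - h) v).
      by change (h v = iter n T x v + - (iter n T x v - h v)); ring.
    by rewrite (le_trans (le_normcD _ _))// normcN.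
  rewrite hv modulus_real//.
  have := normc_le_nrm (iter n T x - h) v.
  move: (normc (iter n T x v)) (normc ((iter n T x - h) v)) => p q.
  move: xh; lra.
exists n => [|v vr].
  rewrite leqNgt; apply/negP => nn0; have := big_v w wr.
  rewrite ltNge => /negP; apply; rewrite (le_trans (normc_le_nrm _ _))//.
  rewrite (le_trans (nrm_shift_iter _ _))// ler_wpM2r ?nrm_ge0//.
  by rewrite le_max ler_weXn2l ?orbT ?(shift_ge1 TM) ?(ltnW nn0).
have [u Cu] : exists u, C' < normc (iter n T (delta u) v).
  apply: contrapT => nu; have : normc (iter n T x v) <= C' * nrm x.
    apply: shift_iter_coord_le => // u _.
    by rewrite leNgt; apply/negP => Cu; apply: nu; exists u.
  by rewrite leNgt big_v.
have [c [a ua]] := shift_iter_delta n u.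
have cv : iter n T (delta u) v = if v == a then c else 0.
  rewrite ua; change (c * delta a v = if v == a then c else 0).
  by rewrite deltaE; case: eqP; rewrite ?mulr1 ?mulr0.
move: Cu; rewrite cv; case: eqP => [->|_]; last by rewrite modulus0 ltNge C'0.
exists u, c; split=> //; apply: le_lt_trans Cu.
by rewrite /C' le_max lexx.
Qed.

End Iterates.

(** * Powers and a single stage *)

Section Power.
Variables (R : realType) (A : countType).
Local Notation X := (ell1 R A).

(** The exponent is shifted because the unit is not summable. *)
Definition ell1_powS (x : X) (m : nat) : X := iter m (ell1_mul x) x.

Lemma ell1_powSE x m v : ell1_powS x m v = x v ^+ m.+1.
Proof.
elim: m => [|m IH]; first by rewrite expr1.
by rewrite exprS -IH.
Qed.

Lemma delta_image_sumE (r : seq A) (p : A -> A) (z : A -> R[i]) a :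
  uniq r -> {in r &, injective p} -> a \in r ->
  (\sum_(v <- r) z v *: delta R (p v)) (p a) = z a.
Proof.
move=> ur pinj ar; rewrite ell1_sumE (bigD1_seq a)//= big_seq_cond big1.
  rewrite addr0 -[LHS]/(z a * delta R (p a) (p a)).
  by rewrite deltaE eqxx mulr1.
move=> v /andP[vr va]; rewrite -[LHS]/(z v * delta R (p v) (p a)) deltaE.
case: eqP => [|_]; last by rewrite mulr0.
by move/(pinj _ _ ar vr)=> av; rewrite av eqxx in va.
Qed.

Lemma delta_image_sum0 (r : seq A) (p : A -> A) (z : A -> R[i]) u :
  (forall v, v \in r -> u <> p v) ->
  (\sum_(v <- r) z v *: delta R (p v)) u = 0.
Proof.
move=> up; rewrite ell1_sumE big_seq big1// => v vr.
rewrite -[LHS]/(z v * delta R (p v) u) deltaE.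
by case: eqP => [/up|]; rewrite ?mulr0//; case.
Qed.

Lemma ell1_powS_delta_sum (r : seq A) (p : A -> A) (z : A -> R[i]) m :
  uniq r -> {in r &, injective p} ->
  ell1_powS (\sum_(v <- r) z v *: delta R (p v)) m =
  \sum_(v <- r) z v ^+ m.+1 *: delta R (p v).
Proof.
move=> ur pinj; apply: ell1P => u; rewrite ell1_powSE.
have [[a ar ->]|nu] := EM (exists2 a, a \in r & u = p a).
  rewrite delta_image_sumE//.
  by rewrite (@delta_image_sumE r p (fun v => z v ^+ m.+1)).
have up v : v \in r -> u <> p v by move=> vr uv; apply: nu; exists v.
by rewrite delta_image_sum0// (@delta_image_sum0 r p (fun v => z v ^+ m.+1))// exprS mul0r.
Qed.

End Power.

Section Stage.
Variables (R : realType) (A : countType) (T : ell1 R A -> ell1 R A) (M : R).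
Hypothesis TM : nilpotent_shift T M.
Local Notation X := (ell1 R A).
Local Notation delta := (delta R).
Local Notation level := (level TM).

(** The vector s has one entry for each entry of the target h, placed at a far
    descendant u of v at which iter n T acts as multiplication by a huge c; that
    entry is an (N+1)-st root of h v / c. The power N+1 of s is then sent exactly
    onto h, while higher powers contain an additional factor that is as small as
    s itself. *)
Lemma stage_exists (hypT : hypercyclic T) (h : X) (r : seq A) (N n0 : nat)
    (e : R) : uniq r -> (forall v, v \notin r -> h v = 0) -> 0 < e ->
  exists (n b : nat) (s : X), [/\ (n0 <= n <= b)%N,
    forall u, s u <> 0 -> (n < level u <= b)%N,
    forall u, h u <> 0 -> (level u <= b)%N &
    [/\ nrm s <= e, iter n T (ell1_powS s N) = h &
    forall m, (N < m)%N -> nrm (iter n T (ell1_powS s m)) <= e]].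
Proof.
move=> ur hr e0; pose D := nrm h + 1 + (size r)%:R.
have h0 := nrm_ge0 h; have r0 : 0 <= (size r)%:R :> R by [].
have D0 : 0 < D by rewrite /D; lra.
(* The entries of s will have modulus at most e1, which bounds both the norm
   of s and e1 * nrm h by e. *)
pose e1 := Num.min 1 (e / D).
have e10 : 0 < e1 by rewrite lt_min ltr01 divr_gt0.
have e1e : e1 * D <= e by rewrite -ler_pdivlMr// ge_min lexx orbT.
have e1le1 : e1 <= 1 by rewrite ge_min lexx.
pose C := (nrm h + 1) / e1 ^+ N.+1.
have e1N : 0 < e1 ^+ N.+1 by rewrite exprn_gt0.
have C0 : 0 < C by rewrite divr_gt0// ltr_wpDl.
have [n n0n Hn] := shift_growth TM hypT r C n0.
have /choice[pc pcP] : forall v, exists pc : A * R[i], v \in r ->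
    iter n T (delta pc.1) = pc.2 *: delta v /\ C < normc pc.2.
  move=> v; case: (boolP (v \in r)) => [/Hn[u [c uc]]|_]; first by exists (u, c).
  by exists (v, 0).
pose p v := (pc v).1; pose c v := (pc v).2.
have pE v : v \in r -> iter n T (delta (p v)) = c v *: delta v.
  by move=> /pcP[].
have cC v : v \in r -> C < normc (c v) by move=> /pcP[].
have c0 v : v \in r -> c v != 0.
  move=> /cC; apply: contraTneq => ->; rewrite modulus0.
  by rewrite -leNgt ltW.
have pinj : {in r &, injective p}.
  move=> v w vr wr vw; have : (c v *: delta v) v = (c w *: delta w) v.
    by rewrite -!pE// vw.
  change (c v * delta v v = c w * delta w v -> v = w); rewrite !deltaE eqxx.
  case: (v =P w) => // _; rewrite mulr0 mulr1 => /eqP.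
  by rewrite (negPf (c0 _ vr)).
pose z v := N.+1.-root (h v / c v).
have zN v : v \in r -> z v ^+ N.+1 * c v = h v.
  by move=> vr; rewrite rootCK// mulfVK ?c0.
have ze v : v \in r -> normc (z v) <= e1.
  move=> vr; rewrite -(@ler_pXn2r _ N.+1)// ?nnegrE ?normc_ge0 ?(ltW e10)//.
  have := congr1 (@normc R) (zN v vr); rewrite normcM modulusX => zc.
  have cv := cC v vr; have hv := normc_le_nrm h v.
  have c0' : 0 < normc (c v) by exact: lt_trans C0 cv.
  rewrite -(@ler_pM2r _ (normc (c v)))// zc (le_trans hv)//.
  rewrite (@le_trans _ _ (e1 ^+ N.+1 * C))//; last by rewrite ler_wpM2l// ltW.
  by rewrite /C mulrC divfK ?lt0r_neq0// lerDl.
pose s : X := \sum_(v <- r) z v *: delta (p v).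
have sE m : iter n T (ell1_powS s m) = \sum_(v <- r) (z v ^+ m.+1 * c v) *: delta v.
  rewrite ell1_powS_delta_sum// (shift_iter_sum TM) [LHS]big_seq [RHS]big_seq.
  by apply: eq_bigr => v vr; rewrite (shift_iterZ TM) pE// scalerA.
have s_out u : s u <> 0 -> exists2 v, v \in r & u = p v.
  move=> su; apply: contrapT => nu; apply: su; apply: delta_image_sum0 => v vr uv.
  by apply: nu; exists v.
have s_off u : u \notin map p r -> s u = 0.
  move=> upr; apply: delta_image_sum0 => v vr uv.
  by move: upr; rewrite uv map_f.
have [b1 sb] := level_bound TM s_off.
have [b2 hb] := level_bound TM hr.
exists n, (n + b1 + b2)%N, s; split.
- by rewrite n0n -addnA leq_addr.
- move=> u su; rewrite (leq_trans (sb u su)); last by lia.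
  rewrite andbT ltnNge; apply/negP => /level_leP un.
  have [v vr uv] := s_out u su; have := congr1 (fun x : X => x v) (pE v vr).
  rewrite /= -uv un -[RHS]/(c v * delta v v) deltaE eqxx mulr1 => /esym/eqP.
  by rewrite (negPf (c0 v vr)).
- by move=> u /hb ub; rewrite (leq_trans ub)// leq_addl.
split.
- rewrite (le_trans (nrm_sum _ _ _))// (@le_trans _ _ (\sum_(v <- r) e1))//.
    rewrite [leLHS]big_seq [leRHS]big_seq; apply: ler_sum => v vr.
    by rewrite nrmZ nrm_delta mulr1 ze.
  rewrite big_const_seq count_predT iter_addr_0 -mulr_natr (le_trans _ e1e)// ler_wpM2l ?(ltW e10)//.
  by rewrite /D; lra.
- rewrite sE; apply: ell1P => v.
  rewrite (@delta_sumE _ _ r (fun v => z v ^+ N.+1 * c v))//.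
  by case: (boolP (v \in r)) => [/zN//|/hr].
move=> m Nm; rewrite sE (le_trans (nrm_sum _ _ _))//.
rewrite (@le_trans _ _ (\sum_(v <- r) e1 * normc (h v)))//.
  rewrite [leLHS]big_seq [leRHS]big_seq; apply: ler_sum => v vr.
  rewrite nrmZ nrm_delta mulr1 (_ : m.+1 = (m - N.+1).+1 + N.+1)%N; last by lia.
  rewrite exprD -mulrA zN// normcM ler_wpM2r ?normc_ge0// modulusX exprS.
  rewrite (le_trans _ (ze v vr))// ler_piMr ?normc_ge0// exprn_ile1 ?normc_ge0//.
  exact: le_trans (ze v vr) e1le1.
rewrite -mulr_sumr (le_trans _ e1e)// ler_wpM2l ?(ltW e10)//.
by rewrite (le_trans (sum_le_nrm h ur))// /D; lra.
Qed.

End Stage.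

(** * Kronecker substitution *)

Section Kronecker.
Variables (R : realType) (d : nat) (idx : 'I_d -> nat).
Local Notation multinom := (mpoly.multinom d).
Local Notation exponent := mpoly.fun_of_multinom.
Local Notation polynomial := (mpoly.mpoly d R[i]).
Implicit Types (K : nat) (m : multinom) (P : polynomial).

Lemma digits_inj K L (a b : nat -> nat) :
  (forall j, a j <= K)%N -> (forall j, b j <= K)%N ->
  (\sum_(j < L) a j * K.+1 ^ j = \sum_(j < L) b j * K.+1 ^ j)%N ->
  forall j, (j < L)%N -> a j = b j.
Proof.
elim: L a b => // L IH a b aK bK.
have shift (f : nat -> nat) : (\sum_(j < L.+1) f j * K.+1 ^ j =
    (\sum_(j < L) f j.+1 * K.+1 ^ j) * K.+1 + f 0)%N.
  rewrite big_ord_recl expn0 muln1 addnC big_distrl/=; congr (_ + _)%N.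
  by apply: eq_bigr => j _; rewrite /bump add1n expnSr mulnA.
rewrite !shift => ab.
have ab0 : a 0%N = b 0%N.
  by have := congr1 (modn^~ K.+1) ab; rewrite /= !modnMDl !modn_small ?ltnS.
move: ab; rewrite ab0 => /addIn/eqP; rewrite eqn_pmul2r// => /eqP.
move=> /(IH (a \o S) (b \o S) (fun j => aK j.+1) (fun j => bK j.+1)) ab' [//|j].
exact: ab'.
Qed.

(** The exponent of s in the monomial m after the substitution of s ^+ (K+1)^j for
    the variable of index j: this is Kronecker substitution. *)
Definition kron_weight K m : nat := \sum_(i < d) exponent m i * K.+1 ^ idx i.

Lemma kron_weight_gt0 K m : m <> mpoly.mnm0 -> (0 < kron_weight K m)%N.
Proof.
move=> m0; rewrite lt0n; apply/negP => /eqP w0; apply: m0.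
apply/mpoly.mnmP => i; rewrite mpoly.mnm0E; apply/eqP.
move/eqP: w0; rewrite sum_nat_eq0 => /forallP/(_ i)/=.
by rewrite muln_eq0 expn_eq0 orbF.
Qed.

(** The exponents of m are the digits of its weight in base K+1. *)
Lemma kron_weight_inj K m1 m2 : injective idx ->
  (mpoly.mdeg m1 <= K)%N -> (mpoly.mdeg m2 <= K)%N ->
  kron_weight K m1 = kron_weight K m2 -> m1 = m2.
Proof.
move=> idx_inj.
pose a m (j : nat) := (\sum_(i < d | idx i == j) exponent m i)%N.
pose L := (\max_(i < d) idx i).+1.
have iL i : (idx i < L)%N by rewrite ltnS (leq_bigmax i).
have aE m : kron_weight K m = (\sum_(j < L) a m j * K.+1 ^ j)%N.
  rewrite /kron_weight (partition_big (fun i => Ordinal (iL i)) xpredT)//=.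
  apply: eq_bigr => j _; rewrite big_distrl/=.
  by apply: eq_big => [i|i /eqP <-//]; rewrite -val_eqE.
have aK m : (mpoly.mdeg m <= K)%N -> forall j, (a m j <= K)%N.
  move=> mK j; rewrite (leq_trans _ mK)// mpoly.mdegE /a big_mkcond/=.
  by apply: leq_sum => i _; case: ifP.
move=> /aK a1 /aK a2; rewrite !aE => /(digits_inj a1 a2) a12.
apply/mpoly.mnmP => i; have := a12 _ (iL i).
by rewrite /a !(big_pred1 i)// => k; rewrite (inj_eq idx_inj).
Qed.

Lemma meval_kronecker K (s : R[i]) P :
  mpoly.meval (fun i => s ^+ (K.+1 ^ idx i)) P =
  \sum_(m <- mpoly.msupp P) mpoly.mcoeff m P * s ^+ kron_weight K m.
Proof.
rewrite mpoly.mevalE; apply: eq_bigr => m _; congr (_ * _).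
rewrite /kron_weight expr_sum; apply: eq_bigr => i _.
by rewrite -exprM mulnC.
Qed.

(** For a large base distinct monomials of P get distinct weights, so the one of
    least weight dominates the others for small values of s. *)
Lemma kron_dominant P : injective idx -> P <> 0 ->
  exists K m0, m0 \in mpoly.msupp P /\
    forall m, m \in mpoly.msupp P -> m != m0 ->
      (kron_weight K m0 < kron_weight K m)%N.
Proof.
move=> idx_inj P0.
pose K := (\max_(m <- mpoly.msupp P) mpoly.mdeg m)%N.
have PK m : m \in mpoly.msupp P -> (mpoly.mdeg m <= K)%N.
  by move=> mP; exact: leq_bigmax_seq.
have [m1 m1P] : exists m, m \in mpoly.msupp P.
  case E : (mpoly.msupp P) => [|m l]; last by exists m; rewrite mem_head.
  by case: P0; apply/eqP; rewrite -mpoly.msupp_eq0 E.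
have ex : exists w, has (fun m => kron_weight K m == w) (mpoly.msupp P).
  by exists (kron_weight K m1); apply/hasP; exists m1.
case: (ex_minnP ex) => w /hasP[m0 m0P /eqP m0w] wmin.
exists K, m0; split=> // m mP mm0; rewrite ltn_neqAle m0w wmin ?andbT; last first.
  by apply/hasP; exists m.
apply: contra mm0; rewrite -m0w => /eqP ww.
by apply/eqP/(kron_weight_inj idx_inj (PK _ mP) (PK _ m0P)).
Qed.

End Kronecker.

(** * Superposition of the stages *)

Section Stages.
Variables (R : realType) (A : countType) (T : ell1 R A -> ell1 R A) (M : R).
Hypothesis TM : nilpotent_shift T M.
Local Notation X := (ell1 R A).
Local Notation level := (level TM).
Local Notation half := (2^-1 : R).

(** Stage k is the vector s k of stage_exists for the target h k and the power
    N k + 1. The levels occupied by the stages, as well as those of the targets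
    used so far, are separated by the times n k: at time n k everything placed
    before stage k is annihilated, and everything placed after stage k is so small
    that M ^+ n k cannot make it visible. *)
Record stages (h : nat -> X) (N : nat -> nat) (n b : nat -> nat) (s : nat -> X)
    : Prop := Stages {
  stage_time : forall k, (n k <= b k)%N;
  stage_next : forall k, (b k < n k.+1)%N;
  stage_support : forall k u, s k u <> 0 -> (n k < level u <= b k)%N;
  stage_target : forall k u, h k u <> 0 -> (level u <= b k)%N;
  stage_small : forall k, nrm (s k.+1) <= half ^+ k.+1 / M ^+ n k;
  stage_le1 : forall k, nrm (s k) <= 1;
  stage_hit : forall k, iter (n k) T (ell1_powS (s k) (N k)) = h k;
  stage_rest : forall k m, (N k < m)%N ->
    nrm (iter (n k) T (ell1_powS (s k) m)) <= half ^+ k }.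

Lemma stages_exist (h : nat -> X) (N : nat -> nat) : hypercyclic T ->
  (forall k, exists r, uniq r /\ forall v, v \notin r -> h k v = 0) ->
  exists n b s, stages h N n b s.
Proof.
move=> hypT hfin.
pose ok k n0 e (w : nat * nat * X) := let: (n, b, s) := w in
  [/\ (n0 <= n <= b)%N,
    forall u, s u <> 0 -> (n < level u <= b)%N,
    forall u, h k u <> 0 -> (level u <= b)%N &
    [/\ nrm s <= e, iter n T (ell1_powS s (N k)) = h k &
    forall m, (N k < m)%N -> nrm (iter n T (ell1_powS s m)) <= e]].
have /choice[f fP] : forall p : nat * nat * R, exists w, 0 < p.2 ->
    ok p.1.1 p.1.2 p.2 w.
  move=> [[k n0] e]; have [r [ur rk]] := hfin k.
  have [e0|] := boolP (0 < e); last by move=> /negP ne; exists (0%N, 0%N, 0).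
  have [n [b [s H]]] := stage_exists TM hypT (N k) n0 ur rk e0.
  by exists (n, b, s).
(* Stage k+1 avoids the levels up to b k, and its size is measured against the
   growth M ^+ n k of the iterates that will be applied to it. *)
pose next k (w : nat * nat * X) :=
  f (k.+1, w.1.2.+1, half ^+ k.+1 / M ^+ w.1.1).
pose w := fix w k := if k is k'.+1 then next k' (w k') else f (0%N, 0%N, 1).
have M0 := shiftM_gt0 TM.
have e0 k n : 0 < half ^+ k / M ^+ n by rewrite divr_gt0 ?half_gt0 ?exprn_gt0.
have e_le k n : half ^+ k / M ^+ n <= half ^+ k.
  by rewrite ler_pdivrMr ?exprn_gt0// ler_peMr ?(ltW (half_gt0 R _))// exprn_ege1// (shift_ge1 TM).
have half_le1 k : half ^+ k <= 1.
  by rewrite exprn_ile1 ?invr_ge0// invf_le1// ler1n.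
have wS k : ok k.+1 (w k).1.2.+1 (half ^+ k.+1 / M ^+ (w k).1.1) (w k.+1).
  exact: (fP (k.+1, (w k).1.2.+1, half ^+ k.+1 / M ^+ (w k).1.1) (e0 _ _)).
have w0 : ok 0%N 0%N 1 (w 0%N) by exact: (fP (0%N, 0%N, 1) ltr01).
have wok k : exists n0 e, [/\ e <= half ^+ k & ok k n0 e (w k)].
  case: k => [|k]; first by exists 0%N, 1; rewrite expr0.
  by exists (w k).1.2.+1, (half ^+ k.+1 / M ^+ (w k).1.1).
exists (fun k => (w k).1.1), (fun k => (w k).1.2), (fun k => (w k).2); split=> k.
- by have [n0 [e [_]]] := wok k; case: (w k) => -[n b] s [/andP[]].
- by have := wS k; case: (w k.+1) => -[n b] s [/andP[]].
- by have [n0 [e [_]]] := wok k; case: (w k) => -[n b] s [].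
- by have [n0 [e [_]]] := wok k; case: (w k) => -[n b] s [].
- by have := wS k; case: (w k.+1) => -[n b] s [_ _ _ []].
- have [n0 [e [ek]]] := wok k; case: (w k) => -[n b] s [_ _ _ [se _ _]] /=.
  by rewrite (le_trans se)// (le_trans ek).
- by have [n0 [e [_]]] := wok k; case: (w k) => -[n b] s [_ _ _ []].
- have [n0 [e [ek]]] := wok k; case: (w k) => -[n b] s [_ _ _ [_ _ se]] m Nm /=.
  by rewrite (le_trans (se m Nm)).
Qed.

Variables (h : nat -> X) (K N n b : nat -> nat) (s : nat -> X).
Hypothesis hst : stages h N n b s.

Lemma stage_b_lt k l : (k < l)%N -> (b k < n l)%N.
Proof.
elim: l => // l IH; rewrite ltnS leq_eqVlt => /orP[/eqP ->|kl].
  exact: stage_next hst l.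
rewrite (ltn_trans (IH kl))// (leq_ltn_trans (stage_time hst l))//.
exact: stage_next hst l.
Qed.

Lemma stage_n_le k l : (k <= l)%N -> (n k <= n l)%N.
Proof.
rewrite leq_eqVlt => /orP[/eqP ->//|/stage_b_lt kl].
by rewrite (leq_trans (stage_time hst k))// ltnW.
Qed.

Lemma stage_b_ge k : (k <= b k)%N.
Proof.
elim: k => // k IH; rewrite (leq_ltn_trans IH)//.
by rewrite (leq_trans (stage_next hst k))// (stage_time hst).
Qed.

Lemma stage_of_subproof u : exists k, (level u <= b k)%N.
Proof. by exists (level u); exact: stage_b_ge. Qed.

Definition stage_of u := ex_minn (stage_of_subproof u).

Lemma stage_of_gt k u : (b k < level u)%N -> (k < stage_of u)%N.
Proof.
rewrite /stage_of; case: ex_minnP => l ul _ ku; rewrite ltnNge; apply/negP => lk.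
move: lk; rewrite leq_eqVlt => /orP[/eqP lk|/stage_b_lt lk].
  by rewrite lk leqNgt ku in ul.
by have := stage_time hst k; lia.
Qed.

Lemma stage_of_eq k u : (n k < level u <= b k)%N -> stage_of u = k.
Proof.
move=> /andP[nu ub]; rewrite /stage_of; case: ex_minnP => l ul lmin.
apply/eqP; rewrite eqn_leq lmin// leqNgt; apply/negP => /stage_b_lt; lia.
Qed.

(** The stages occupy disjoint ranges of levels, so that their vectors can be
    superposed into a single function. *)
Definition sigma u : R[i] := s (stage_of u) u.

Lemma sigma_le1 u : normc (sigma u) <= 1.
Proof. exact: le_trans (normc_le_nrm _ _) (stage_le1 hst _). Qed.

(** The bounds on the stages after k form a geometric series, and each of them
    contains the factor M ^- n k. *)
Lemma sigma_tail k :
  (norm1 (fun u => if (b k < level u)%N then sigma u else 0%R) <=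
   (half ^+ k / M ^+ n k)%:E)%E.
Proof.
have M0 := shiftM_gt0 TM.
apply: norm1_le_seq => r ur; pose L := (maxn k (\max_(u <- r) stage_of u)).
rewrite (@le_trans _ R (\sum_(u <- r) \sum_(k <= j < L) (normc (s j.+1 u) : R)))//.
  rewrite [leLHS]big_seq [leRHS]big_seq; apply: ler_sum => u ur'.
  case: ifPn => [ku|_]; last first.
    by rewrite modulus0 sumr_ge0// => j _; rewrite normc_ge0.
  have kj := stage_of_gt ku; rewrite /sigma.
  have jL : (stage_of u <= L)%N.
    by rewrite /L leq_max (leq_bigmax_seq _ ur')// orbT.
  case: (stage_of u) kj jL => // j kj jL.
  have jkL : j \in index_iota k L by rewrite mem_index_iota -ltnS kj.
  rewrite (bigD1_seq j) ?iota_uniq//=.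
  by rewrite lerDl sumr_ge0// => i _; rewrite normc_ge0.
rewrite exchange_big/= (@le_trans _ _ (\sum_(k <= j < L) half ^+ j.+1 / M ^+ n k))//.
  apply: ler_sum_nat => j /andP[kj _].
  rewrite (le_trans (sum_le_nrm _ ur))// (le_trans (stage_small hst j))//.
  rewrite ler_wpM2l ?(ltW (half_gt0 R _))// lef_pV2 ?posrE ?exprn_gt0//.
  by rewrite ler_weXn2l ?(shift_ge1 TM)// stage_n_le.
rewrite -mulr_suml ler_wpM2r ?invr_ge0 ?exprn_ge0 ?(ltW M0)//.
have kL : (k <= L)%N by exact: leq_maxl.
rewrite (le_trans (half_sum R kL))//.
by rewrite lerBlDr lerDl ltW// half_gt0.
Qed.

(** The i-th generator is the target h i, followed by powers of sigma. The power
    (K+1)^i turns the evaluation of a polynomial at the generators into a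
    Kronecker substitution, with the base K prescribed by the stage. *)
Definition gen_fun (i : nat) u : R[i] := if (level u <= b i)%N then h i u
  else sigma u ^+ ((K (stage_of u)).+1 ^ i).

Lemma gen_exists : exists g : nat -> X,
  (forall i u, g i u = gen_fun i u) /\ forall i, nrm (g i - h i) <= half ^+ i.
Proof.
have M0 := shiftM_gt0 TM.
suff /choice[g gP] : forall i, exists x : X,
    (forall u, x u = gen_fun i u) /\ nrm (x - h i) <= half ^+ i.
  by exists g; split=> i; have [] := gP i.
move=> i; have [y yE ysmall] := ell1_exists (sigma_tail i).
have [|t tE tsmall] := @ell1_dominated _ _ (fun u => if (b i < level u)%N then
    sigma u ^+ ((K (stage_of u)).+1 ^ i) else 0) y 1 ler01.
  move=> u; rewrite yE mul1r; case: ifP => // _; rewrite modulusX.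
  have : (0 < (K (stage_of u)).+1 ^ i)%N by rewrite expn_gt0.
  case: (_ ^ i)%N => // q _; rewrite exprS ler_piMr ?normc_ge0//.
  by rewrite exprn_ile1 ?normc_ge0 ?sigma_le1.
exists (h i + t); split=> [u|].
  rewrite -[LHS]/(h i u + t u) tE /gen_fun ltnNge.
  case hu: (level u <= b i)%N => /=; first by rewrite addr0.
  by have [->|/eqP/(stage_target hst)] := eqVneq (h i u) 0; rewrite ?add0r// hu.
rewrite addrAC subrr add0r (le_trans tsmall)// mul1r (le_trans ysmall)//.
rewrite ler_pdivrMr ?exprn_gt0// ler_peMr ?(ltW (half_gt0 R _))//.
by rewrite exprn_ege1// (shift_ge1 TM).
Qed.

End Stages.

(** * Dense targets and hypercyclicity of polynomial values *)

Section Targets.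
Variables (R : realType) (A : countType).
Local Notation X := (ell1 R A).
Local Notation delta := (delta R).

Lemma rat_complex_dense (z : R[i]) (e : R) : 0 < e ->
  exists p : rat * rat, normc ((ratr p.1 +i* ratr p.2)%C - z) < e.
Proof.
case: z => a b e0; have e2 : 0 < e / 2 by rewrite divr_gt0.
have near (t : R) : exists q : rat, `|ratr q - t| < e / 2.
  have [|q] := @rat_in_itvoo R (t - e / 2) (t + e / 2); first by lra.
  by rewrite in_itv/= => /andP[? ?]; exists q; rewrite ltr_distl; apply/andP.
have [p pa] := near a; have [q qb] := near b; exists (p, q).
have -> : ((ratr p +i* ratr q) - (a +i* b) =
    ((ratr p - a) +i* 0) + (0 +i* (ratr q - b)))%C.
  by congr Complex; rewrite ?addr0 ?add0r.
rewrite (le_lt_trans (le_normcD _ _))//= !expr0n/= addr0 add0r !sqrtr_sqr.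
lra.
Qed.

Definition code_vec (c : seq (A * (rat * rat))) : X :=
  \sum_(t <- c) (ratr t.2.1 +i* ratr t.2.2)%C *: delta t.1.

Lemma code_vec_support c v : v \notin map fst c -> code_vec c v = 0.
Proof.
move=> vc; rewrite /code_vec ell1_sumE big_seq big1// => t tc.
rewrite -[LHS]/((ratr t.2.1 +i* ratr t.2.2)%C * delta t.1 v) deltaE.
case: eqP => [vt|_]; last by rewrite mulr0.
by move: vc; rewrite vt map_f.
Qed.

(** Truncation followed by rational approximation of the finitely many entries. *)
Lemma code_vec_dense (x : X) (e : R) : 0 < e ->
  exists c, nrm (code_vec c - x) < e.
Proof.
move=> e0; have e2 : 0 < e / 2 by rewrite divr_gt0.
have [r [ur xr]] := truncation x e2.
have D0 : 0 < (size r)%:R + 1 :> R by rewrite ltr_wpDl.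
have eD : 0 < e / 2 / ((size r)%:R + 1) by rewrite divr_gt0.
have /choice[q qP] := fun v => @rat_complex_dense (x v) _ eD.
exists [seq (v, q v) | v <- r].
rewrite (le_lt_trans (nrm_sub_trans (\sum_(v <- r) x v *: delta v) _ _))//.
rewrite (nrm_sub_sym _ x) /code_vec big_map -sumrB.
suff : nrm (\sum_(v <- r) ((ratr (q v).1 +i* ratr (q v).2)%C *: delta v
    - x v *: delta v)) < e / 2 by move: xr; lra.
rewrite (le_lt_trans (nrm_sum _ _ _))//.
rewrite (@le_lt_trans _ R (\sum_(v <- r) e / 2 / ((size r)%:R + 1)))//.
  apply: ler_sum => v _; rewrite -scalerBl nrmZ nrm_delta mulr1.
  exact: ltW (qP v).
rewrite big_const_seq count_predT iter_addr_0 -[ltLHS]mulr_natr.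
by rewrite mulrC mulrA ltr_pdivrMr// mulrC ltr_pM2l// ltrDl.
Qed.

(** Every pair (K0, N0) recurs with every target, since each natural number is the
    2-adic valuation of arbitrarily large integers. *)
Lemma targets_exist : exists (h : nat -> X) (K N : nat -> nat),
  (forall k, exists r, uniq r /\ forall v, v \notin r -> h k v = 0) /\
  forall x (e : R) K0 N0 k0, 0 < e ->
    exists k, [/\ (k0 <= k)%N, K k = K0, N k = N0 & nrm (h k - x) < e].
Proof.
pose task k : seq (A * (rat * rat)) * (nat * nat) :=
  odflt ([::], (0, 0)%N) (unpickle (logn 2 k.+1)).
have taskE w k0 : exists2 k, (k0 <= k)%N & task k = w.
  pose l := (2 ^ pickle w * (2 * k0).+1)%N.
  have l0 : (0 < l)%N by rewrite muln_gt0 expn_gt0.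
  exists l.-1; last first.
    rewrite /task prednK// lognM ?expn_gt0// pfactorK//.
    rewrite (@lognE 2 (2 * k0).+1) dvdn2 /= mul2n odd_double/= addn0.
    by rewrite pickleK.
  rewrite -ltnS prednK// (@leq_trans (2 * k0).+1)//; first by lia.
  by rewrite leq_pmull// expn_gt0.
exists (fun k => code_vec (task k).1), (fun k => (task k).2.1),
  (fun k => (task k).2.2); split=> [k|x e K0 N0 k0 e0].
  exists (undup (map fst (task k).1)); split; first exact: undup_uniq.
  by move=> v; rewrite mem_undup; exact: code_vec_support.
have [c cx] := code_vec_dense x e0.
have [k k0k kE] := taskE (c, (K0, N0)) k0.
by exists k; rewrite kE.
Qed.

End Targets.

Section Generators.
Variables (R : realType) (A : countType) (T : ell1 R A -> ell1 R A) (M : R).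
Hypothesis TM : nilpotent_shift T M.
Local Notation X := (ell1 R A).
Local Notation level := (level TM).
Local Notation half := (2^-1 : R).
Variables (h : nat -> X) (K N n b : nat -> nat) (s : nat -> X).
Hypothesis hst : stages TM h N n b s.
Hypothesis hdense : forall x (e : R) K0 N0 k0, 0 < e ->
  exists k, [/\ (k0 <= k)%N, K k = K0, N k = N0 & nrm (h k - x) < e].
Variable g : nat -> X.
Hypothesis gE : forall i u, g i u = gen_fun K hst i u.
Hypothesis gh : forall i, nrm (g i - h i) <= half ^+ i.

Lemma gen_sigma i k u : (i < k)%N -> (n k < level u)%N ->
  g i u = sigma hst u ^+ ((K (stage_of hst u)).+1 ^ i).
Proof.
move=> ik nu; rewrite gE /gen_fun ifF//; apply/negP => ui.
by have := stage_b_lt hst ik; lia.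
Qed.

Section OnePolynomial.
Variables (d : nat) (idx : 'I_d -> nat) (P : mpoly.mpoly d R[i]) (x : X).
Hypothesis P_noconst : mpoly.mcoeff mpoly.mnm0 P = 0.
Hypothesis xP : forall v, x v = mpoly.meval (fun i => g (idx i) v) P.

Let Pnorm : R := \sum_(m <- mpoly.msupp P) (normc (mpoly.mcoeff m P) : R).

Lemma msupp_weight_gt0 J m : m \in mpoly.msupp P -> (0 < kron_weight idx J m)%N.
Proof.
move=> mP; apply: kron_weight_gt0 => m0; move: mP.
by rewrite m0 mpoly.mcoeff_msupp P_noconst eqxx.
Qed.

Lemma poly_sigma k u : (forall i, (idx i < k)%N) -> (n k < level u)%N ->
  x u = \sum_(m <- mpoly.msupp P)
    mpoly.mcoeff m P * sigma hst u ^+ kron_weight idx (K (stage_of hst u)) m.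
Proof.
move=> ik nu; rewrite xP -meval_kronecker; apply: mpoly.meval_eq => i.
exact: gen_sigma (ik i) nu.
Qed.

(** Every monomial of P has positive weight and sigma has modulus at most 1, so
    beyond stage k the values of x are dominated by those of sigma. *)
Lemma poly_tail k : (forall i, (idx i < k)%N) ->
  exists2 t : X, (forall u, t u = if (b k < level u)%N then x u else 0) &
    nrm (iter (n k) T t) <= Pnorm * half ^+ k.
Proof.
move=> ik; have M0 := shiftM_gt0 TM.
have [y yE ysmall] := ell1_exists (sigma_tail hst k).
have Pnorm0 : 0 <= Pnorm by apply: sumr_ge0 => m _; exact: normc_ge0.
have [|t tE tsmall] := @ell1_dominated _ _
    (fun u => if (b k < level u)%N then x u else 0) y Pnorm Pnorm0.
  move=> u; rewrite yE; case: ifP => [bu|_]; last by rewrite modulus0 mulr0.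
  rewrite (poly_sigma ik) ?(leq_ltn_trans (stage_time hst k))//.
  rewrite (le_trans (modulus_sum _ _))// mulr_suml.
  rewrite [leLHS]big_seq [leRHS]big_seq; apply: ler_sum => m mP.
  rewrite normcM ler_wpM2l ?normc_ge0// modulusX.
  have := msupp_weight_gt0 (K (stage_of hst u)) mP.
  case: (kron_weight _ _ _) => // w _; rewrite exprS ler_piMr ?normc_ge0//.
  by rewrite exprn_ile1 ?normc_ge0 ?sigma_le1.
exists t => //; rewrite (le_trans (nrm_shift_iter TM _ _))//.
rewrite (@le_trans _ R (M ^+ n k * (Pnorm * (half ^+ k / M ^+ n k))))//.
  rewrite ler_wpM2l ?exprn_ge0 ?(ltW M0)// (le_trans tsmall)//.
  by rewrite ler_wpM2l.
have Mn0 : M ^+ n k != 0 by rewrite lt0r_neq0// exprn_gt0.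
by rewrite mulrCA (mulrCA (M ^+ n k)) divff// mulr1.
Qed.

(** The coordinates of x split at the levels n k and b k. The lower part is
    annihilated and the upper part is negligible; the middle part is a combination
    of powers of s k, of which the lowest one is sent onto h k and the others
    onto small vectors. *)
Lemma poly_stage k m0 : (forall i, (idx i < k)%N) ->
  m0 \in mpoly.msupp P ->
  (forall m, m \in mpoly.msupp P -> m != m0 ->
    (kron_weight idx (K k) m0 < kron_weight idx (K k) m)%N) ->
  N k = (kron_weight idx (K k) m0).-1 ->
  nrm (iter (n k) T x - mpoly.mcoeff m0 P *: h k) <= 2 * Pnorm * half ^+ k.
Proof.
move=> ik m0P m0min Nk.
have [t tE tsmall] := poly_tail ik.
pose w m := kron_weight idx (K k) m.
pose y : X := \sum_(m <- mpoly.msupp P) mpoly.mcoeff m P *: ell1_powS (s k) (w m).-1.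
have s0 u : ~~ (n k < level u <= b k)%N -> s k u = 0.
  by move=> nu; apply: contrapT => /(stage_support hst); rewrite (negPf nu).
have yE u : y u = \sum_(m <- mpoly.msupp P) mpoly.mcoeff m P * s k u ^+ w m.
  rewrite /y ell1_sumE [LHS]big_seq [RHS]big_seq; apply: eq_bigr => m mP.
  rewrite -[LHS]/(mpoly.mcoeff m P * ell1_powS (s k) (w m).-1 u) ell1_powSE.
  by rewrite prednK// msupp_weight_gt0.
have y0 u : ~~ (n k < level u <= b k)%N -> y u = 0.
  move=> /s0 su; rewrite yE big_seq big1// => m mP; rewrite su expr0n.
  by rewrite gtn_eqF ?mulr0// msupp_weight_gt0.
(* The remainder lives on the levels up to n k: strictly between n k and b k,
   both inclusive at the top, x agrees with y, and above b k with t. *)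
have low0 : iter (n k) T (x - y - t) = 0.
  apply: (shift_iter_vanish TM) => u; rewrite -[X in X <> _]/(x u - y u - t u) tE.
  move=> xyt; apply/(level_leP TM); case: leqP => // nu; case: xyt.
  case: ltnP => ub; first by rewrite y0 ?subr0 ?subrr// nu/= -ltnNge.
  rewrite subr0 yE (poly_sigma ik nu) /sigma.
  by rewrite (@stage_of_eq _ _ _ _ _ _ _ _ _ _ hst k) ?nu// subrr.
have -> : x = (x - y - t) + (y + t) by rewrite addrA addrAC !subrK.
rewrite (shift_iterD TM _ (x - y - t)) low0 add0r (shift_iterD TM _ y) addrAC (le_trans (nrmD _ _))//.
suff : nrm (iter (n k) T y - mpoly.mcoeff m0 P *: h k) <= Pnorm * half ^+ k.
  by move: tsmall; lra.
rewrite (shift_iter_sum TM) (bigD1_seq m0)//= ?mpoly.msupp_uniq//.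
rewrite (shift_iterZ TM) -Nk (stage_hit hst) addrAC subrr add0r.
rewrite (le_trans (nrm_sum _ _ _))// /Pnorm mulr_suml.
rewrite big_seq_cond [leRHS](bigD1_seq m0)//= ?mpoly.msupp_uniq//.
rewrite [X in _ + X]big_seq_cond ler_wpDl//.
  by rewrite mulr_ge0 ?normc_ge0 ?(ltW (half_gt0 _ _)).
apply: ler_sum => m /andP[mP mm0].
rewrite (shift_iterZ TM) nrmZ ler_wpM2l ?normc_ge0// (stage_rest hst)// Nk.
by have := m0min m mP mm0; have := msupp_weight_gt0 (K k) m0P; rewrite /w; lia.
Qed.

(** Infinitely many stages have the base K and the power at which one fixed
    monomial of P dominates; their targets are dense, also after multiplication
    by the coefficient of that monomial. *)
Lemma poly_hypercyclic : injective idx -> P <> 0 -> HC T x.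
Proof.
move=> idx_inj P0; have [K0 [m0 [m0P m0min]]] := kron_dominant idx_inj P0.
set c := mpoly.mcoeff m0 P.
have c0 : c != 0 by rewrite -mpoly.mcoeff_msupp.
have cn0 : 0 < normc c.
  by rewrite lt_neqAle normc_ge0 andbT eq_sym; apply: contra c0 => /eqP/eq0_normc/eqP.
have Pnorm0 : 0 <= Pnorm by apply: sumr_ge0 => m _; exact: normc_ge0.
apply/dense_nrmP => z e e0.
have e1 : 0 < e / 2 / normc c by rewrite !divr_gt0.
have D0 : 0 < 2 * Pnorm + 1 by lra.
have [k1 k1P] : exists k0, forall k, (k0 <= k)%N ->
    half ^+ k < e / 2 / (2 * Pnorm + 1).
  by apply: half_small; rewrite !divr_gt0.
pose k0 := maxn k1 (\max_(i < d) (idx i).+1).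
have [k [k0k Kk Nk hk]] :=
  hdense (c^-1 *: z) K0 (kron_weight idx K0 m0).-1 k0 e1.
have ik i : (idx i < k)%N.
  rewrite (leq_trans _ k0k)// /k0 leq_max; apply/orP; right.
  exact: (leq_bigmax i).
exists (iter (n k) T x); first by exists (n k).
have := poly_stage ik m0P; rewrite Kk => /(_ m0min Nk) xk.
rewrite (le_lt_trans (nrm_sub_trans (c *: h k) _ _))//.
have hz : nrm (c *: h k - z) < e / 2.
  have -> : c *: h k - z = c *: (h k - c^-1 *: z).
    by rewrite scalerBr scalerA divff// scale1r.
  by rewrite nrmZ mulrC -ltr_pdivlMr.
have : half ^+ k * (2 * Pnorm + 1) < e / 2.
  by rewrite -ltr_pdivlMr// k1P// (leq_trans _ k0k)// leq_maxl.
have := half_gt0 R k.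
move: xk hz; rewrite -/c; lra.
Qed.

End OnePolynomial.
End Generators.

(** * The algebra *)

Section Algebra.
Variables (R : realType) (A : countType).
Local Notation X := (ell1 R A).

Lemma generated_subalgebra_closed (G : set X) : subalgebra (generated_subalgebra G).
Proof.
split.
- by move=> S [[]].
- by move=> x y xG yG S SG; have [[_ + _ _] _] := SG; apply; [exact: xG|exact: yG].
- by move=> c x xG S SG; have [[_ _ + _] _] := SG; apply; exact: xG.
- by move=> x y xG yG S SG; have [[_ _ _] + _] := SG; apply; [exact: xG|exact: yG].
Qed.

Definition poly_values (g : nat -> X) : set X := [set x |
  exists d (P : mpoly.mpoly d R[i]), mpoly.mcoeff mpoly.mnm0 P = 0 /\
    forall v, x v = mpoly.meval (fun i : 'I_d => g i v) P].

(** Evaluation is a ring morphism compatible with substitution, hence so is the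
    constant term. *)
Lemma mcoeff0_meval d (P : mpoly.mpoly d R[i]) :
  mpoly.mcoeff mpoly.mnm0 P = mpoly.meval (fun=> 0) P.
Proof.
have at0 (m : mpoly.multinom d) :
    \prod_(i < d) (0 : R[i]) ^+ mpoly.fun_of_multinom m i =
    if m == mpoly.mnm0 then 1 else 0.
  case: eqP => [->|m0]; first by apply: big1 => i _; rewrite mpoly.mnm0E expr0.
  have [i mi] : exists i, mpoly.fun_of_multinom m i != 0%N.
    apply: contrapT => nm; apply: m0; apply/mpoly.mnmP => i.
    by rewrite mpoly.mnm0E; apply: contrapT => /eqP mi; apply: nm; exists i.
  by rewrite (bigD1 i)//= expr0n (negPf mi) mul0r.
rewrite mpoly.mevalE; under eq_bigr do rewrite at0.
have [P0|] := boolP (mpoly.mnm0 \in mpoly.msupp P); last first.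
  move=> P0; rewrite big_seq big1 => [|m mP].
    by apply/eqP; rewrite -[_ == _]negbK -mpoly.mcoeff_msupp.
  by case: eqP mP P0 => [-> ->//|]; rewrite mulr0.
rewrite (bigD1_seq mpoly.mnm0) ?mpoly.msupp_uniq//= eqxx mulr1.
by rewrite big1 ?addr0// => m /negPf ->; rewrite mulr0.
Qed.

(** Elements of the algebra involve different numbers of generators; adding dummy
    variables makes two of them comparable. *)
Lemma mpoly_widen d e (P : mpoly.mpoly d R[i]) : (d <= e)%N ->
  exists Q : mpoly.mpoly e R[i], mpoly.mcoeff mpoly.mnm0 Q = mpoly.mcoeff mpoly.mnm0 P /\
    forall z : nat -> R[i],
      mpoly.meval (fun i : 'I_e => z i) Q = mpoly.meval (fun i : 'I_d => z i) P.
Proof.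
move=> de.
pose lq := [tuple mpoly.mpolyX R[i] (mpoly.mnm1 (widen_ord de i)) | i < d].
have QE v : mpoly.meval v (mpoly.comp_mpoly lq P) =
    mpoly.meval (fun i => v (widen_ord de i)) P.
  rewrite mpoly.comp_mpoly_meval; apply: mpoly.meval_eq => i.
  by rewrite tnth_mktuple mpoly.mevalXU.
exists (mpoly.comp_mpoly lq P); split; last by move=> z; rewrite QE.
by rewrite !mcoeff0_meval QE.
Qed.

Lemma poly_values_subalgebra (g : nat -> X) : subalgebra (poly_values g).
Proof.
have common x y : poly_values g x -> poly_values g y ->
    exists d (P Q : mpoly.mpoly d R[i]),
    [/\ mpoly.mcoeff mpoly.mnm0 P = 0, mpoly.mcoeff mpoly.mnm0 Q = 0,
        forall v, x v = mpoly.meval (fun i : 'I_d => g i v) P &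
        forall v, y v = mpoly.meval (fun i : 'I_d => g i v) Q].
  move=> [d [P [P0 xP]]] [e [Q [Q0 yQ]]]; exists (maxn d e).
  have [P' [P'0 P'E]] := mpoly_widen P (leq_maxl d e).
  have [Q' [Q'0 Q'E]] := mpoly_widen Q (leq_maxr d e).
  exists P', Q'; split; rewrite ?P'0 ?Q'0// => v.
    by rewrite (P'E (fun i => g i v)).
  by rewrite (Q'E (fun i => g i v)).
split.
- by exists 0%N, 0; rewrite mpoly.mcoeff0; split=> // v; rewrite mpoly.meval0.
- move=> x y gx gy; have [d [P [Q [P0 Q0 xP yQ]]]] := common x y gx gy.
  exists d, (P + Q); rewrite mpoly.mcoeffD P0 Q0 addr0; split=> // v.
  by rewrite mpoly.mevalD -xP -yQ.
- move=> c x [d [P [P0 xP]]]; exists d, (c *: P).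
  rewrite mpoly.mcoeffZ P0 mulr0; split=> // v.
  by rewrite mpoly.mevalZ -xP.
- move=> x y gx gy; have [d [P [Q [P0 Q0 xP yQ]]]] := common x y gx gy.
  exists d, (P * Q); split=> [|v]; last by rewrite mpoly.mevalM -xP -yQ.
  by move: P0; rewrite !mcoeff0_meval mpoly.mevalM => ->; rewrite mul0r.
Qed.

Lemma generated_subalgebra_poly (g : nat -> X) :
  generated_subalgebra (range g) `<=` poly_values g.
Proof.
move=> x; apply; split; first exact: poly_values_subalgebra.
move=> _ [i _ <-]; exists i.+1, (mpoly.mpolyX R[i] (mpoly.mnm1 ord_max)).
by rewrite mcoeff0_meval; split=> [|v]; rewrite mpoly.mevalXU.
Qed.

End Algebra.

Section Main.
Variables (R : realType) (A : countType) (T : ell1 R A -> ell1 R A) (M : R).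
Hypothesis TM : nilpotent_shift T M.
Local Notation X := (ell1 R A).

Lemma zero_not_hypercyclic (v : A) : ~ HC T 0.
Proof.
move/dense_nrmP => /(_ (delta R v) 1 ltr01)[_ [n _ <-]].
by rewrite (shift_iter0 TM) sub0r nrmN nrm_delta ltxx.
Qed.

(** The generators are indexed injectively by idx because algebraic independence
    is about arbitrary finite subfamilies. *)
Definition hypercyclic_family (g : nat -> X) : Prop :=
  forall d (idx : 'I_d -> nat) (P : mpoly.mpoly d R[i]) (x : X),
    mpoly.mcoeff mpoly.mnm0 P = 0 ->
    (forall v, x v = mpoly.meval (fun i => g (idx i) v) P) ->
    injective idx -> P <> 0 -> HC T x.

Lemma hypercyclic_family_exists : hypercyclic T -> exists g : nat -> X,
  hypercyclic_family g /\
  forall x (e : R), 0 < e -> exists k, nrm (g k - x) < e.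
Proof.
move=> hypT; have [h [K [N [hfin hdense]]]] := targets_exist R A.
have [n [b [s hst]]] := stages_exist TM N hypT hfin.
have [g [gE gh]] := gen_exists K hst; exists g; split.
  by move=> d idx P x P0 xP; exact: (poly_hypercyclic hdense gE P0 xP).
move=> x e e0; have e2 : 0 < e / 2 by rewrite divr_gt0.
have [k0 k0P] := half_small e2.
have [k [k0k _ _ hk]] := hdense x _ 0%N 0%N k0 e2.
exists k; rewrite (le_lt_trans (nrm_sub_trans (h k) _ _))//.
have := gh k; have := k0P k k0k; move: hk; lra.
Qed.

(** Since 0 is not hypercyclic, no admissible polynomial vanishes at the family.
    Injectivity is the case of the polynomial X - Y. *)
Lemma free_of_hypercyclic_family (v0 : A) (g : nat -> X) :
  hypercyclic_family g ->
  [/\ injective g, algebraically_independent (range g) &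
      hypercyclic_algebra T (generated_subalgebra (range g))].
Proof.
move=> gH; have no0 := zero_not_hypercyclic v0.
have indep d (idx : 'I_d -> nat) (P : mpoly.mpoly d R[i]) : injective idx ->
    mpoly.mcoeff mpoly.mnm0 P = 0 -> P <> 0 ->
    ~ forall v, mpoly.meval (fun i => g (idx i) v) P = 0.
  move=> idx_inj P0 Pn0 Pv; by apply: no0; apply: (gH d idx P).
have ginj : injective g.
  move=> i j gij; apply: contrapT => ij.
  pose idx (k : 'I_2) := if k == ord0 then i else j.
  pose V k : mpoly.mpoly 2 R[i] := mpoly.mpolyX R[i] (mpoly.mnm1 k).
  apply: (indep 2%N idx (V ord0 - V ord_max)).
  - move=> k l; rewrite /idx.
    have [->|k0] := eqVneq k ord0; have [->|l0] := eqVneq l ord0 => //.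
      by move=> e; case: (ij (esym e)).
    move=> _; apply/val_inj; move: k0 l0; rewrite -!val_eqE/=.
    by have := ltn_ord k; have := ltn_ord l; lia.
  - by rewrite mcoeff0_meval mpoly.mevalB !mpoly.mevalXU subrr.
  - move=> V0; have := congr1 (mpoly.meval (fun k : 'I_2 => (k == ord0)%:R)) V0.
    rewrite mpoly.mevalB !mpoly.mevalXU mpoly.meval0/= subr0 => /eqP.
    by rewrite oner_eq0.
  - by move=> v; rewrite mpoly.mevalB !mpoly.mevalXU /idx/= gij subrr.
split=> //.
- move=> d gg P d0 gginj gg_in Pn0 P0 Pg.
  have /choice[idx idxE] : forall i, exists j, g j = gg i.
    by move=> i; have [j _ ji] := gg_in i; exists j.
  apply: (indep d idx P) => // [i j ij|v].
    by apply: gginj; rewrite -!idxE ij.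
  rewrite -[RHS]/((fun=> 0 : R[i]) v) -Pg; apply: mpoly.meval_eq => i.
  by rewrite idxE.
have SHC : generated_subalgebra (range g) `<=` HC T `|` [set 0].
  move=> x /generated_subalgebra_poly[d [P [P0 xP]]].
  have [P00|/eqP Pn0] := eqVneq P 0.
    right; apply: ell1P => v; rewrite xP P00; exact: mpoly.meval0.
  by left; apply: (gH d (fun i => i) P x P0 xP) => // i j; exact: val_inj.
have Gg i : generated_subalgebra (range g) (g i).
  by move=> S [_]; apply; exists i.
split=> //; first exact: generated_subalgebra_closed.
move=> S0; have g00 : g 0%N = 0 by have := Gg 0%N; rewrite S0.
have g10 : g 1%N = 0 by have := Gg 1%N; rewrite S0.
by have := ginj 0%N 1%N; rewrite g00 g10 => /(_ erefl).
Qed.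

Lemma nilpotent_shift_dense_algebra (v0 : A) : hypercyclic T ->
  exists S, [/\ hypercyclic_algebra T S, dense S & countably_generated_free S].
Proof.
move=> /hypercyclic_family_exists[g [gH gd]].
have [ginj gind galg] := free_of_hypercyclic_family v0 gH.
exists (generated_subalgebra (range g)); split=> //.
  apply/dense_nrmP => x e /(gd x)[k gk]; exists (g k) => //.
  by move=> S [_]; apply; exists k.
exists (range g); split=> //.
by apply: inj_card_eq => i j _ _ /ginj.
Qed.

End Main.

(** * The equivalence *)

Lemma hypercyclic_algebra_hypercyclic (R : realType) (A : countType)
    (T : ell1 R A -> ell1 R A) S : hypercyclic_algebra T S -> hypercyclic T.
Proof.
move=> [[S0 _ _ _] Sn0 SHC]; apply: contrapT => nT; apply: Sn0.
apply/seteqP; split=> [x Sx|_ ->//].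
by have [xT|//] := SHC x Sx; case: nT; exists x.
Qed.

Theorem corollary3p2 (R : realType) (A : countType) (E : set (A * A))
    (lambda : A -> R[i]) (B : ell1 R A -> ell1 R A) :
  directed_tree E -> leafless E -> rooted E ->
  (forall v, lambda v != 0) ->
  is_weighted_backward_shift E lambda B -> bounded_operator B ->
  (hypercyclic B <-> exists S, hypercyclic_algebra B S) /\
  ((exists S, hypercyclic_algebra B S) <->
   exists S, [/\ hypercyclic_algebra B S, dense S & countably_generated_free S]).
Proof.
move=> treeE _ rootE _ shiftB boundB.
have [M BM] := backward_shift_nilpotent treeE rootE shiftB boundB.
have [r _] := rootE.
have free := nilpotent_shift_dense_algebra BM r.
split; split.
- by move=> /free[S [SB _ _]]; exists S.
- by move=> [S]; exact: hypercyclic_algebra_hypercyclic.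
- by move=> [S /hypercyclic_algebra_hypercyclic/free].
- by move=> [S [SB _ _]]; exists S.
Qed.
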